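(* Let $V=\{v_1,\dots,v_n\}$ be finite, $f:2^V\to\mathbb{R}_{\ge 0}$ a non-negative, normalized, monotone submodular function, and $t_1,\dots,t_k\in V$ distinct terminals. Let $\mathrm{OPT}_{frac}$ be the optimum value of the convex program $$\min \sum_{i=1}^k \hat f(\mathbf{x}_i)\quad\text{s.t. } \sum_{i=1}^k x(v,i)=1\ \forall v\in V,\ \ x(t_i,i)=1\ \forall i\in[k],\ \ x(v,i)\ge 0\ \forall v\in V, i\in[k],$$ where $\mathbf{x}_i=(x(v_1,i),\dots,x(v_n,i))$. Let $A_1,\dots,A_k$ be the output of the following randomized procedure: take an optimal solution $\mathbf{x}$ of this program; choose $\theta\in[\frac14,1]$ uniformly at random; set $A(i,\theta)=\{v\in V: x(v,i)\ge\theta\}$ for $i\in[k]$ and $U(\theta)=V\setminus\bigcup_{i=1}^k A(i,\theta)$; for every $v$ lying in more than one of the sets $A(i,\theta)$, delete $v$ from all but one of them (arbitrarily); return $A_i=A(i,\theta)$ for $i\le k-1$ and $A_k=A(k,\theta)\cup U(\theta)$. Then $$\mathbb{E}\Big[\sum_{i=1}^k f(A_i)\Big]\le\frac43\,\mathrm{OPT}_{frac}.$$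
   Context: Normalized means $f(\emptyset)=0$; monotone means $f(A)\le f(B)$ for $A\subseteq B$; submodular means $f(A)+f(B)\ge f(A\cap B)+f(A\cup B)$. For $\mathbf{x}\in[0,1]^V$ and $\theta\in[0,1]$, let $\mathbf{x}^\theta=\{v\in V: x_v\ge\theta\}$. The Lovász extension is $\hat f(\mathbf{x})=\int_0^1 f(\mathbf{x}^\theta)\,d\theta$. *)

(* Defs.v *)
From HB Require Import structures.
From mathcomp Require Export all_boot all_order all_algebra.
From mathcomp Require Export all_classical all_reals all_analysis.
Export Order.TTheory GRing.Theory Num.Theory.
Export numFieldNormedType.Exports.

Set Implicit Arguments.
Unset Strict Implicit.
Unset Printing Implicit Defensive.

Local Open Scope classical_set_scope.
Local Open Scope ring_scope.

Section SetFunctions.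
Context (R : realType) (V : finType).
Implicit Types (f : {set V} -> R) (y : V -> R).

Definition nonnegative_setfun f := forall A, 0 <= f A.

Definition normalized_setfun f := f finset.set0 = 0.

Definition monotone_setfun f :=
  forall A B : {set V}, A \subset B -> f A <= f B.

Definition submodular_setfun f :=
  forall A B : {set V}, f (A :&: B)%SET + f (A :|: B)%SET <= f A + f B.

Definition level_set y (theta : R) : {set V} := [set v | theta <= y v]%SET.

Definition lovasz f y : R :=
  \int[lebesgue_measure]_(theta in `[0, 1]) f (level_set y theta).

End SetFunctions.

(* The parts are indexed by 'I_k.+1, so that there is at least one terminal
   and the last index is ord_max. *)
Section ConvexProgram.
Context (R : realType) (V : finType) (k : nat).
Implicit Types (f : {set V} -> R) (t : 'I_k.+1 -> V)
  (x : V -> 'I_k.+1 -> R).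

Definition feasible t x :=
  [/\ forall v, \sum_i x v i = 1,
      forall i, x (t i) i = 1 &
      forall v i, 0 <= x v i].

Definition objective f x : R := \sum_i lovasz f (fun v => x v i).

Definition optimal_solution f t x :=
  feasible t x /\ forall y, feasible t y -> objective f x <= objective f y.

Definition opt_frac f t : R := inf [set objective f x | x in feasible t].

End ConvexProgram.

Section Rounding.
Context (R : realType) (V : finType) (k : nat).
Implicit Types (A B : 'I_k.+1 -> {set V}) (x : V -> 'I_k.+1 -> R).

Definition threshold_sets x (theta : R) (i : 'I_k.+1) : {set V} :=
  level_set (fun v => x v i) theta.

Definition unassigned A : {set V} := (~: \bigcup_i A i)%SET.

(* B arises from A by deleting every element that lies in several of the A i
   from all but one of them. *)
Definition deduplication A B := forall v,
  let I := [set i | v \in A i]%SET in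
  let J := [set i | v \in B i]%SET in
  if (1 < #|I|)%N then exists2 j, j \in I & J = [set j]%SET else J = I.

(* A relation rather than a function, since the deletions are arbitrary. *)
Definition rounding_output x (theta : R) A :=
  exists2 B, deduplication (threshold_sets x theta) B &
    forall i, A i = if i == ord_max
                    then (B i :|: unassigned (threshold_sets x theta))%SET
                    else B i.

End Rounding.

Lemma quarter_lt1 (R : realType) : 4^-1 < 1 :> R.
Proof. by rewrite invf_lt1 ?ltr1n ?ltr0n. Qed.

(* Main.v *)
From HB Require Import structures.
Require Import Defs.
From mathcomp Require Import measurable_realfun ring lra.

Set Implicit Arguments.
Unset Strict Implicit.
Unset Printing Implicit Defensive.

Local Open Scope classical_set_scope.
Local Open Scope ring_scope.

(* By subadditivity the rounded solution costs at most the sum of the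
   f(A(i,theta)) plus f(U(theta)), and averaging over [1/4,1] costs a factor 4/3
   compared to integrating. So it suffices to charge the integral of f(U(theta))
   over [1/4,1] to the unused integrals of the f(A(i,theta)) over [0,1/4].
   With m_v = max_i x(v,i) we have U(theta) = {v : m_v < theta}. Edmonds' greedy
   algorithm gives weights w >= 0 with w(S) <= f(S) for every S, with equality
   on the sets U(theta); replacing f by w, the claim becomes the pointwise
   inequality 1 - m <= sum_i min(x_i, 1/4). If m <= 1/4 the right-hand side is 1;
   otherwise min(x_i, 1/4) >= x_i/(4m), and 1/(4m) >= 1 - m. *)

(** * Submodular functions and greedy weights *)

Section SubmodularFunctions.
Context (R : realType) (V : finType).
Implicit Types (f : {set V} -> R) (S : {set V}).

Lemma submodular_setfunU f (A B : {set V}) :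
  nonnegative_setfun f -> submodular_setfun f ->
  f (A :|: B)%SET <= f A + f B.
Proof.
by move=> f_ge0 /(_ A B); apply: le_trans; rewrite lerDr.
Qed.

(* Edmonds' greedy vertex of the polymatroid of [f], for the ordering of the
   elements by increasing [y]. *)
Lemma greedy_weights f (y : V -> R) :
  normalized_setfun f -> monotone_setfun f -> submodular_setfun f ->
  exists w : V -> R, [/\ forall v, 0 <= w v,
    forall S, \sum_(v in S) w v <= f S &
    forall S, (forall u v, v \in S -> y u <= y v -> u \in S) ->
      \sum_(v in S) w v = f S].
Proof.
move=> f0 f_mono f_sub.
(* Induction on the size of a ground set [D], removing an element with the largest [y]; being a
   lower set is relative to [D]. *)
suff greedy n (D : {set V}) : #|D| = n -> exists w : V -> R,
    [/\ forall v, 0 <= w v,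
      forall S, S \subset D -> \sum_(v in S) w v <= f S &
      forall S, S \subset D ->
        (forall u v, u \in D -> v \in S -> y u <= y v -> u \in S) ->
        \sum_(v in S) w v = f S].
  have [w [w_ge0 w_le w_eq]] := greedy _ [set: V]%SET erefl.
  exists w; split=> // S; first by apply: w_le; rewrite finset.subsetT.
  by move=> S_low; apply: w_eq => [|u v _]; [rewrite finset.subsetT | exact: S_low].
elim: n D => [|n IHn] D cardD.
  have D0 := cards0_eq cardD.
  exists (fun=> 0); split=> // S; rewrite D0 finset.subset0 => /eqP->;
    by rewrite ?big_set0 f0.
have /card_gt0P[v0 v0D] : (0 < #|D|)%N by rewrite cardD.
have [a aD a_max] : exists2 a, a \in D & forall v, v \in D -> y v <= y a.
  by case: (arg_maxP y v0D) => a; exists a.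
have cardDa : #|(D :\ a)%SET| = n.
  by apply/eqP; rewrite -eqSS -cardD (cardsD1 a D) aD.
have [w [w_ge0 w_le w_eq]] := IHn _ cardDa.
have f_inc : 0 <= f D - f (D :\ a)%SET by rewrite subr_ge0 f_mono// subD1set.
(* The last element [a] receives its marginal value on top of all the others. *)
pose w' v := if v == a then f D - f (D :\ a)%SET else w v.
have w'sum S : \sum_(v in (S :\ a)%SET) w' v = \sum_(v in (S :\ a)%SET) w v.
  by apply: eq_bigr => v; rewrite /w' !inE => /andP[/negbTE->].
have w'a S : a \in S ->
    \sum_(v in S) w' v = f D - f (D :\ a)%SET + \sum_(v in (S :\ a)%SET) w v.
  by move=> aS; rewrite (big_setD1 a)//= w'sum /w' eqxx.
have Sa0 S : a \notin S -> (S :\ a)%SET = S.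
  by move=> aS; apply/finset.setDidPl; rewrite disjoint_sym disjoints1.
exists w'; split=> [v|S SD|S SD S_low].
- by rewrite /w'; case: ifP.
- have SaD : (S :\ a)%SET \subset (D :\ a)%SET by exact: finset.setSD.
  have [aS|aS] := boolP (a \in S); last first.
    by rewrite -(Sa0 _ aS) w'sum; apply: w_le.
  (* Diminishing returns: adding [a] to [D :\ a] gains at most as much as adding it to the smaller
     set [S :\ a]. *)
  rewrite w'a//; have := f_sub S (D :\ a)%SET.
  have -> : (S :&: (D :\ a) = S :\ a)%SET.
    by rewrite finset.setIDA (finset.setIidPl SD).
  have -> : (S :|: (D :\ a) = D)%SET.
    apply/eqP; rewrite finset.eqEsubset finset.subUset SD subD1set/=.
    apply/fintype.subsetP => v vD; rewrite !inE vD andbT.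
    by case: eqP => [->|]; rewrite ?aS ?orbT.
  by have := w_le _ SaD; lra.
(* A lower set containing the maximiser [a] is all of [D]; any other lies in [D :\ a], where
   induction applies. *)
- have [aS|aS] := boolP (a \in S).
    have -> : S = D.
      apply/eqP; rewrite finset.eqEsubset SD/=; apply/fintype.subsetP => v vD.
      exact: (S_low _ _ vD aS (a_max v vD)).
    rewrite w'a// (w_eq (D :\ a)%SET) ?subrK//.
  have SaD : (S :\ a)%SET \subset (D :\ a)%SET by exact: finset.setSD.
  rewrite -(Sa0 _ aS) w'sum; apply: w_eq => // u v.
  by rewrite (Sa0 _ aS) => /setD1P[_ uD]; exact: S_low.
Qed.

End SubmodularFunctions.

Lemma sum_min_quarter (R : realFieldType) (I : finType) (y : I -> R) (m : R) :
  (forall i, 0 <= y i <= m) -> \sum_i y i = 1 ->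
  1 - m <= \sum_i Num.min (y i) 4^-1.
Proof.
move=> y_bd y_sum.
have [m4|m4] := leP m 4^-1.
  rewrite (eq_bigr y) ?y_sum; last first.
    by move=> i _; rewrite min_l//; have := y_bd i; lra.
  (* Any index yields [0 <= m]; having none would contradict [y_sum]. *)
  have [i|I0] := pickP (fun _ : I => true); first by have := y_bd i; lra.
  by move: y_sum; rewrite big_pred0// => /eqP; rewrite eq_sym oner_eq0.
have m0 : 0 < m by lra.
have y_le i : (4 * m)^-1 * y i <= Num.min (y i) 4^-1.
  have /andP[y0 ym] := y_bd i.
  rewrite mulrC ler_pdivrMr ?mulr_gt0//.
  case: (leP (y i) 4^-1) => _; [nra | lra].
apply: (@le_trans _ _ ((4 * m)^-1)); last first.
  have -> : (4 * m)^-1 = \sum_i (4 * m)^-1 * y i.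
    by rewrite -mulr_sumr y_sum mulr1.
  exact: ler_sum.
rewrite -[leRHS]mul1r ler_pdivlMr ?mulr_gt0//.
(* The inequality [(1 - m) * (4 * m) <= 1] rearranges to this square being nonnegative. *)
by have := sqr_ge0 (2 * m - 1); nra.
Qed.

(** * Measurability and integration of finite-valued maps *)

Section FiniteValuedMaps.
Context d (T : measurableType d) (R : realType) (U : finType).

Lemma measurable_fun_fin_comp (G : T -> U) (F : U -> R) :
  (forall u, measurable [set w | G w = u]) -> measurable_fun setT (F \o G).
Proof.
move=> mG _ Y mY; rewrite setTI.
have -> : (F \o G) @^-1` Y = \bigcup_(u in F @^-1` Y) [set w | G w = u].
  by apply/seteqP; split=> [w Yw|w [u Yu] /= ->//]; exists (G w).
by apply: fin_bigcup_measurable => // u _; exact: mG.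
Qed.

Lemma measurable_mem_fin (G : T -> {set U}) (v : U) :
  (forall S, measurable [set w | G w = S]) -> measurable [set w | v \in G w].
Proof.
move=> mG.
have -> : [set w | v \in G w] =
    \bigcup_(S in [set S : {set U} | v \in S]) [set w | G w = S].
  by apply/seteqP; split=> [w vw|w [u Yu] /= ->//]; exists (G w).
by apply: fin_bigcup_measurable => // u _; exact: mG.
Qed.

(** The integrand is a nonnegative combination of the indicators of the events [v \in G t], so
    integration is termwise. *)
Lemma integral_sum_mem (mu : {measure set T -> \bar R}) (D : set T)
    (G : T -> {set U}) (w : U -> R) :
  measurable D -> (forall S, measurable [set t | G t = S]) ->
  (forall v, 0 <= w v) ->
  (\int[mu]_(t in D) (\sum_(v in G t) w v)%:E =
   \sum_v (w v)%:E * mu ([set t | v \in G t] `&` D))%E.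
Proof.
move=> mD mG w_ge0.
have mv v : measurable [set t | v \in G t] by exact: measurable_mem_fin.
under eq_integral => t _.
  rewrite big_mkcond/= -sumEFin.
  under eq_bigr => v _.
    have -> : (if v \in G t then w v else 0)%:E =
        ((w v)%:E * (\1_[set t | v \in G t] t)%:E)%E.
      rewrite indicE -EFinM; congr EFin.
      case: ifPn => vG; first by rewrite mem_set// mulr1.
      by rewrite memNset ?mulr0//; exact/negP.
    over.
  over.
rewrite ge0_integral_sum//.
- apply: eq_bigr => v _; rewrite ge0_integralZl_EFin//.
  + by rewrite integral_indic.
  + by apply/measurable_EFinP; apply: measurable_indic.
- move=> v; apply: measurable_funeM.
  by apply/measurable_EFinP; apply: measurable_indic.
- by move=> v t _; rewrite mule_ge0// lee_fin.
Qed.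

End FiniteValuedMaps.

(** * Level sets and the Lovász extension *)

Section LevelSets.
Context (R : realType) (V : finType).
Implicit Types (f : {set V} -> R) (y : V -> R).

Lemma measurable_level_set y (S : {set V}) :
  measurable [set theta | level_set y theta = S].
Proof.
have -> : [set theta | level_set y theta = S] =
    \bigcap_(v in [set: V]) [set theta | (theta <= y v) = (v \in S)].
  apply/seteqP; split=> [theta <- v _|theta yS]/=; first by rewrite inE.
  by apply/setP => v; rewrite inE; exact: yS.
apply: fin_bigcap_measurable => // v _.
have myv : measurable [set theta | theta <= y v].
  by rewrite -[X in measurable X](set_itvNyc (y v)).
case: (v \in S).
  exact: myv.
have -> : [set theta | (theta <= y v) = false] = ~` [set theta | theta <= y v].
  by apply/seteqP; split=> theta /=; [move=> -> | move/negP/negbTE].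
exact: measurableC.
Qed.

Lemma measurable_fun_level_set y (F : {set V} -> R) :
  measurable_fun setT (fun theta => F (level_set y theta)).
Proof. by apply: measurable_fun_fin_comp => S; exact: measurable_level_set. Qed.

(** The integrand is bounded by the value of [f] on the whole of [V], so the integral is finite and
    [fine] loses nothing. *)
Lemma lovaszE f y : nonnegative_setfun f -> monotone_setfun f ->
  ((lovasz f y)%:E =
    \int[lebesgue_measure]_(theta in `[0%R, 1%R]) (f (level_set y theta))%:E)%E.
Proof.
move=> f_ge0 f_mono; rewrite /lovasz /Rintegral fineK//.
rewrite ge0_fin_numE ?integral_ge0//; last by move=> ? _; rewrite lee_fin.
apply: (@le_lt_trans _ _
  (\int[lebesgue_measure]_(theta in `[0%R, 1%R]) (f [set: V]%SET)%:E)%E).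
  apply: ge0_le_integral => //.
  - by move=> ? _; rewrite lee_fin.
  - apply/measurable_EFinP/measurable_funTS; exact: measurable_fun_level_set.
  - by move=> theta _; rewrite lee_fin f_mono// finset.subsetT.
by rewrite integral_cst//= lebesgue_measure_itv/= lte_fin ltr01 -EFinD -EFinM ltry.
Qed.

(* The weights of the greedy vertex for the ordering by [m] bound the left-hand
   side from above by [\sum_v w v * (1 - m v)] and the right-hand side from below
   by [\sum_v w v * \sum_i Num.min (x v i) 4^-1]. *)
Lemma integral_sublevel_le (I : finType) f (x : V -> I -> R) (m : V -> R) :
  nonnegative_setfun f -> normalized_setfun f -> monotone_setfun f ->
  submodular_setfun f ->
  (forall v i, 0 <= x v i <= m v) -> (forall v, m v <= 1) ->
  (forall v, \sum_i x v i = 1) ->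
  (\int[lebesgue_measure]_(theta in `[4^-1%R, 1%R])
      (f (~: level_set m theta)%SET)%:E <=
   \sum_i \int[lebesgue_measure]_(theta in `[0%R, 4^-1%R[)
      (f (level_set (x ^~ i) theta))%:E)%E.
Proof.
move=> f_ge0 f_norm f_mono f_sub x_bd m1 x_sum.
have [w [w_ge0 w_le w_eq]] := greedy_weights m f_norm f_mono f_sub.
have mC S : measurable [set theta : R | (~: level_set m theta)%SET = S].
  have -> : [set theta : R | (~: level_set m theta)%SET = S] =
      [set theta | level_set m theta = (~: S)%SET].
    by apply/seteqP; split=> theta /= => [<-|->]; rewrite finset.setCK.
  exact: measurable_level_set.
under eq_integral => theta _.
  rewrite -w_eq; first over.
  (* Strict sublevel sets of [m] are lower sets, so the weights are exact on them. *)
  move=> u v; rewrite !inE -!ltNge => vt uv; exact: le_lt_trans vt.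
rewrite integral_sum_mem//.
apply: (@le_trans _ _ (\sum_i \sum_v (w v)%:E * lebesgue_measure
    ([set theta | v \in level_set (x ^~ i) theta] `&` `[0%R, 4^-1%R[))%E);
  last first.
  apply: lee_sum => i _.
  rewrite -integral_sum_mem//; last by move=> S; exact: measurable_level_set.
  apply: ge0_le_integral => //.
  - by move=> theta _; rewrite lee_fin sumr_ge0.
  - apply/measurable_EFinP/measurable_funTS.
    exact: (measurable_fun_level_set _ (fun S => \sum_(v in S) w v)).
  - apply/measurable_EFinP/measurable_funTS; exact: measurable_fun_level_set.
  - by move=> theta _; rewrite lee_fin.
(* Both sides are now linear in [w], so it suffices to compare the coefficients of each [w v], which
   are lengths of sets of thresholds. *)
rewrite exchange_big/=; apply: lee_sum => v _.
rewrite -ge0_sume_distrr//; apply: lee_wpmul2l; first by rewrite lee_fin.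
have mv i : measurable [set theta : R | v \in level_set (x ^~ i) theta].
  by apply: measurable_mem_fin; exact: measurable_level_set.
have mCv : measurable [set theta : R | v \in (~: level_set m theta)%SET].
  exact: measurable_mem_fin.
apply: (@le_trans _ _ (lebesgue_measure `]m v, 1%R]%classic)).
  apply: le_measure; [by apply/mem_set; apply: measurableI | exact/mem_set |].
  move=> theta /= [vU]; rewrite !in_itv/= => /andP[_ ->].
  by rewrite andbT ltNge; move: vU; rewrite !inE.
rewrite lebesgue_measure_itv/= lte_fin.
apply: (@le_trans _ _ (1 - m v)%:E).
  by case: ifPn => _ //; rewrite lee_fin subr_ge0.
apply: (@le_trans _ _ (\sum_i (Num.min (x v i) 4^-1)%:E)).
  by rewrite sumEFin lee_fin sum_min_quarter.
apply: lee_sum => i _.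
have min_ge0 : 0 <= Num.min (x v i) 4^-1.
  by have /andP[x0 _] := x_bd v i; rewrite le_min x0 invr_ge0 ler0n.
apply: (@le_trans _ _ (lebesgue_measure `[0%R, Num.min (x v i) 4^-1[%classic)).
  rewrite lebesgue_measure_itv/= lte_fin; case: ifPn => [_|].
    by rewrite oppr0 adde0.
  by rewrite -leNgt lee_fin.
apply: le_measure.
- exact/mem_set.
- by apply/mem_set; apply: measurableI; first exact: mv.
- by move=> theta /=; rewrite !in_itv/= !inE lt_min => /and3P[-> /ltW-> ->].
Qed.

End LevelSets.

(** * Cost of the rounded solution *)

Section Rounding.
Context (R : realType) (V : finType) (k : nat).
Implicit Types (f : {set V} -> R) (x : V -> 'I_k.+1 -> R) (A B : 'I_k.+1 -> {set V}).

Lemma deduplication_subset A B i : deduplication A B -> B i \subset A i.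
Proof.
move=> dedup; apply/fintype.subsetP => v vB; move: (dedup v) => /=.
have : i \in [set j | v \in B j]%SET by rewrite inE.
case: ifP => _ iJ; last by move=> BA; move: iJ; rewrite BA inE.
by case=> j jA BJ; move: iJ; rewrite BJ inE => /eqP->; move: jA; rewrite inE.
Qed.

Lemma sum_rounding_output_le f x theta A :
  nonnegative_setfun f -> monotone_setfun f -> submodular_setfun f ->
  rounding_output x theta A ->
  \sum_i f (A i) <=
  \sum_i f (threshold_sets x theta i) + f (unassigned (threshold_sets x theta)).
Proof.
move=> f_ge0 f_mono f_sub [B dedup AE].
have f_le i : f (B i) <= f (threshold_sets x theta i).
  by apply: f_mono; exact: deduplication_subset.
rewrite (bigD1 ord_max)//= [X in _ <= X + _](bigD1 ord_max)//=.
rewrite addrAC lerD//; last first.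
  by apply: ler_sum => i /negbTE imax; rewrite AE imax.
rewrite AE eqxx; apply: le_trans (submodular_setfunU _ _ f_ge0 f_sub) _.
by rewrite lerD2r.
Qed.

(** Take [m v] to be the largest [x v i]: some part catches [v] exactly when the threshold is at
    most [m v]. Attainment later gives [m v <= 1]. *)
Lemma unassigned_threshold_setsE x : exists m : V -> R,
  [/\ forall v i, x v i <= m v, forall v, exists i, m v = x v i &
    forall theta,
      unassigned (threshold_sets x theta) = (~: level_set m theta)%SET].
Proof.
pose m v := x v [arg max_(i > ord0) x v i]%O.
have m_ub v i : x v i <= m v.
  by rewrite /m; case: arg_maxP => // j _ /(_ i); apply.
exists m; split=> // [v|theta]; first by eexists.
apply/setP => v; rewrite !inE; congr (~~ _).
apply/bigcupP/idP => [[i _]|tm]; first by rewrite inE => /le_trans; apply.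
by eexists=> //; rewrite inE; exact: tm.
Qed.

Lemma measurable_fun_unassigned f x :
  measurable_fun setT (fun theta => f (unassigned (threshold_sets x theta))).
Proof.
have [m [_ _ mE]] := unassigned_threshold_setsE x.
under eq_fun do rewrite mE.
exact: (measurable_fun_level_set m (fun S => f (~: S)%SET)).
Qed.

Lemma opt_frac_optimal f t x :
  optimal_solution f t x -> opt_frac f t = objective f x.
Proof.
move=> [x_feas x_min]; apply/eqP; rewrite eq_le; apply/andP; split.
  apply: ge_inf; last by exists x.
  by exists (objective f x) => _ [y y_feas <-]; exact: x_min.
apply: lb_le_inf; first by exists (objective f x); exists x.
by move=> _ [y y_feas <-]; exact: x_min.
Qed.

(* The cost of the unassigned elements at thresholds [theta >= 1/4] is charged
   to the thresholds [theta < 1/4], at which the sets are not used. *)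
Lemma integral_rounding_cost_le f x :
  nonnegative_setfun f -> normalized_setfun f -> monotone_setfun f ->
  submodular_setfun f -> (forall v i, 0 <= x v i) -> (forall v, \sum_i x v i = 1) ->
  (\int[lebesgue_measure]_(theta in `[4^-1%R, 1%R])
     (\sum_i f (threshold_sets x theta i) +
      f (unassigned (threshold_sets x theta)))%:E <= (objective f x)%:E)%E.
Proof.
move=> f_ge0 f_norm f_mono f_sub x_ge0 x_sum.
have [m [m_ub m_attained mE]] := unassigned_threshold_setsE x.
have m1 v : m v <= 1.
  have [i ->] := m_attained v; rewrite -(x_sum v) (bigD1 i)//= lerDl.
  exact: sumr_ge0.
have mf (y : V -> R) (D : set R) (F : {set V} -> R) :
    measurable_fun D (fun theta => (F (level_set y theta))%:E).
  by apply/measurable_EFinP/measurable_funTS; exact: measurable_fun_level_set.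
under eq_integral => theta _.
  rewrite mE EFinD -sumEFin; over.
rewrite ge0_integralD//=; first last.
- exact: (mf m _ (fun S => f (~: S)%SET)).
- by move=> theta _; rewrite lee_fin.
- by apply: emeasurable_sum => i; exact: mf.
- by move=> theta _; rewrite sume_ge0// => i _; rewrite lee_fin.
rewrite ge0_integral_sum//; first last.
- by move=> i theta _; rewrite lee_fin.
- by move=> i; exact: mf.
have x_bd v i : 0 <= x v i <= m v by rewrite x_ge0 m_ub.
apply: le_trans (leeD2l _ (integral_sublevel_le f_ge0 f_norm f_mono f_sub
  x_bd m1 x_sum)) _.
rewrite -big_split/= /objective -sumEFin; apply: lee_sum => i _.
(* For each [i], the integrals over [[0, 1/4[] and [[1/4, 1]] glue to the Lovász extension. *)
rewrite lovaszE// addeC -ge0_integral_setU//=.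
- by rewrite -itv_bndbnd_setU// bnd_simp ?invr_ge0 ?ltW ?quarter_lt1.
- exact: mf.
- by move=> theta _; rewrite lee_fin.
- apply/disj_setPS => theta [] /=; rewrite !in_itv/= => /andP[_].
  by rewrite ltNge => /negbTE->.
Qed.

End Rounding.

(** Change of variables to the law of [theta], whose density on [[a, b]] is the constant
    [(b - a)^-1]. *)
Lemma expectation_uniform (R : realType) d (T : measurableType d)
    (P : probability T R) (theta : {RV P >-> R}) (a b : R) (ab : a < b)
    (g : R -> R) :
  (forall B, measurable B -> distribution P theta B = uniform_prob ab B) ->
  measurable_fun setT g -> (forall s, 0 <= g s) ->
  ('E_P[g \o theta] =
   ((b - a)^-1)%:E * \int[lebesgue_measure]_(s in `[a, b]) (g s)%:E)%E.
Proof.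
move=> theta_unif mg g_ge0.
(* [uniform_prob] lives on [measurableTypeR R], whose display differs from that
   of the codomain of [theta]. *)
have mtheta : measurable_fun setT (theta : T -> measurableTypeR R).
  exact: (measurable_funP theta).
pose theta' : {mfun T >-> measurableTypeR R} := HB.pack
  (theta : T -> measurableTypeR R) (isMeasurableFun.Build _ _ _ _ _ mtheta).
have mEg : measurable_fun (setT : set (measurableTypeR R)) (EFin \o g).
  exact/measurable_EFinP.
rewrite unlock -(integral_uniform ab mEg)//.
rewrite [RHS](eq_measure_integral (distribution P theta')); last first.
  by move=> B mB _; exact/esym/theta_unif.
by rewrite ge0_integral_distribution.
Qed.

(* The outcome w carries both theta and all the choices made when deleting
   repeated elements, so these may depend on theta and on extra randomness;
   that each A i is a random set makes the expectation meaningful. *)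
Theorem theorem2p1 (R : realType) (V : finType) (k : nat)
  (f : {set V} -> R) (t : 'I_k.+1 -> V) (x : V -> 'I_k.+1 -> R)
  (d : measure_display) (T : measurableType d) (P : probability T R)
  (theta : {RV P >-> R}) (A : T -> 'I_k.+1 -> {set V})
  (f_ge0 : nonnegative_setfun f) (f_norm : normalized_setfun f)
  (f_mono : monotone_setfun f) (f_submod : submodular_setfun f)
  (t_inj : injective t)
  (x_opt : optimal_solution f t x)
  (theta_unif : forall B, measurable B ->
     distribution P theta B = uniform_prob (quarter_lt1 R) B)
  (A_output : forall w, 4^-1 <= theta w <= 1 ->
     rounding_output x (theta w) (A w))
  (A_meas : forall i S, measurable [set w | A w i = S]) :
  ('E_P[fun w => (\sum_i f (A w i))%R] <= (4 / 3 * opt_frac f t)%:E)%E.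
Proof.
have [[x_sum _ x_ge0] _] := x_opt.
rewrite (opt_frac_optimal x_opt).
pose cost s := \sum_i f (threshold_sets x s i) + f (unassigned (threshold_sets x s)).
have cost_ge0 s : 0 <= cost s by rewrite addr_ge0// sumr_ge0.
have m_cost : measurable_fun setT cost.
  apply: measurable_funD.
    by apply: measurable_sum => i; exact: measurable_fun_level_set.
  exact: measurable_fun_unassigned.
apply: (@le_trans _ _ 'E_P[cost \o theta]%E).
  apply: expectation_le.
  - by apply: measurable_sum => i; exact: (measurable_fun_fin_comp f (A_meas i)).
  - exact: measurableT_comp.
  - by move=> w; rewrite sumr_ge0.
  - by move=> w; exact: cost_ge0.
  (* [A_output] speaks only of thresholds in [[1/4, 1]]; the remaining outcomes form a null event,
     since the uniform density vanishes there. *)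
  - exists (theta @^-1` (~` `[4^-1, 1])); split.
    + rewrite -[X in measurable X]setTI.
      by apply: (measurable_funP theta) => //; exact: measurableC.
    + have := theta_unif (~` `[4^-1, 1]); rewrite /distribution /pushforward => ->.
        by rewrite /uniform_prob integral_uniform_pdf setICl integral_set0.
      exact: measurableC.
    + move=> w /= le_fails; rewrite in_itv/= => theta_w; apply: le_fails.
      exact: sum_rounding_output_le f_ge0 f_mono f_submod (A_output _ theta_w).
rewrite (expectation_uniform theta_unif)//.
have -> : (1 - 4^-1)^-1 = 4 / 3 :> R by field.
rewrite [leRHS]EFinM; apply: lee_wpmul2l; first by rewrite lee_fin divr_ge0.
exact: integral_rounding_cost_le.
Qed.
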